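(* Let $K$ be a field, let $I\subset R=K[x_1,\ldots,x_n]$ be a monomial ideal, let $\mathfrak{p}$ be a monomial prime ideal in $R$, let $t\geq 1$, and let $y_1,\ldots,y_s$ be distinct variables in $R$ (that is, distinct elements of $\{x_1,\ldots,x_n\}$) such that, for each $i=1,\ldots,s$, there exist some integer $\alpha_i\geq 1$ and a monomial ideal $J_i$ in $R$ with $y_i\notin \mathrm{supp}(J_i)$ such that $(I^t,y_i^{\alpha_i})=(J_i,y_i^{\alpha_i})$ and $\mathfrak{p}\setminus y_i\notin \mathrm{Ass}(R/J_i)$. Then: (i) $\mathfrak{p}\in \mathrm{Ass}(R/I^t)$ if and only if $\mathfrak{p}\in \mathrm{Ass}\bigl(R/(I^t:\prod_{i=1}^s y_i^{\alpha_i})\bigr)$. (ii) If $\prod_{i=1}^s y_i^{\alpha_i}\in I^\ell$ for some $\ell\geq t$, then $\mathfrak{p}\notin \mathrm{Ass}(R/I^t)$.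
   Context: For an ideal $Q$ of $R$ and $f\in R$, $(Q:f)=\{r\in R\mid rf\in Q\}$, and $(Q,f)$ denotes the ideal $Q+fR$. $\mathrm{Ass}(R/Q)$ is the set of associated primes of $Q$, i.e. the prime ideals of the form $(Q:f)$ with $f\in R$. For a monomial $u$, $\mathrm{supp}(u)$ is the set of variables dividing $u$ (with $\mathrm{supp}(1)=\emptyset$); for a monomial ideal $J$ with unique minimal set of monomial generators $\mathcal{G}(J)$, $\mathrm{supp}(J)=\bigcup_{u\in\mathcal{G}(J)}\mathrm{supp}(u)$. A monomial prime ideal is an ideal generated by a subset of the variables; for such $\mathfrak{p}$ and a variable $y$, $\mathfrak{p}\setminus y$ denotes the ideal of $R$ generated by the variables in $\mathfrak{p}$ other than $y$. *)

(* Defs.v *)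
From mathcomp Require Import all_boot all_order all_algebra.
From mathcomp Require Export mpoly.

Set Implicit Arguments.
Unset Strict Implicit.
Unset Printing Implicit Defensive.

Import GRing.Theory.
Local Open Scope ring_scope.

(* The [idealr] structure of [ring_quotient] is restricted to proper ideals
   with a boolean membership test, whereas sums, powers and colons of
   arbitrary ideals (the unit ideal included) are needed here.  Ideals are
   therefore [Prop]-valued predicates, compared extensionally by [ieq]. *)
Section Ideals.
Variable R : comNzRingType.
Implicit Types (S Q P : R -> Prop) (f : R).

Definition ieq P Q : Prop := forall r, P r <-> Q r.

Definition is_ideal Q : Prop :=
  [/\ Q 0, forall a b, Q a -> Q b -> Q (a + b) & forall r a, Q a -> Q (r * a)].

Definition prime_ideal P : Prop :=
  [/\ is_ideal P, ~ P 1 & forall a b, P (a * b) -> P a \/ P b].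

Definition ideal_gen S : R -> Prop := fun r =>
  exists (k : nat) (c g : 'I_k -> R),
    (forall i, S (g i)) /\ r = \sum_(i < k) c i * g i.

(* For [t = 0] the empty product makes this the unit ideal. *)
Definition ideal_pow Q (t : nat) : R -> Prop :=
  ideal_gen (fun r => exists g : 'I_t -> R,
    (forall i, Q (g i)) /\ r = \prod_(i < t) g i).

Definition ideal_add_elt Q f : R -> Prop := fun r =>
  exists q c, Q q /\ r = q + f * c.

Definition ideal_colon Q f : R -> Prop := fun r => Q (r * f).

(* [ass Q P] : P belongs to Ass(R/Q) *)
Definition ass Q P : Prop :=
  prime_ideal P /\ exists f, ieq P (ideal_colon Q f).

End Ideals.

Section MonomialIdeals.
Variables (n : nat) (K : fieldType).
Implicit Types (J p : {mpoly K[n]} -> Prop) (G : 'X_{1..n} -> Prop).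

(* Monomials are represented by their exponent vectors. *)
Definition mon_gen G : {mpoly K[n]} -> Prop :=
  ideal_gen (fun f => exists2 m, G m & f = 'X_[m]).

Definition monomial_ideal J : Prop := exists G, ieq J (mon_gen G).

Definition min_mon_gens J G : Prop :=
  ieq J (mon_gen G) /\
  forall G' : 'X_{1..n} -> Prop,
    (forall m, G' m -> G m) -> ieq J (mon_gen G') -> forall m, G m -> G' m.

Definition mon_supp (m : 'X_{1..n}) : {set 'I_n} := [set i | m i != 0%N].

(* [ideal_supp J i] : the variable ['X_i] belongs to supp(J); the minimal
   monomial generating set G of a monomial ideal is unique. *)
Definition ideal_supp J (i : 'I_n) : Prop :=
  exists G, min_mon_gens J G /\ exists2 m, G m & i \in mon_supp m.

Definition monomial_prime p : Prop :=
  exists A : {set 'I_n},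
    ieq p (ideal_gen (fun f => exists2 i, i \in A & f = 'X_i)).

(* the ideal generated by the variables in p other than ['X_y] *)
Definition prime_minus p (y : 'I_n) : {mpoly K[n]} -> Prop :=
  ideal_gen (fun f => exists i, [/\ p 'X_i, i != y & f = 'X_i]).

End MonomialIdeals.

(* Main.v *)
Require Import Defs.
From mathcomp Require Import all_boot all_order all_algebra.
From mathcomp Require Import mpoly.
From Stdlib Require Import Classical.

Set Implicit Arguments.
Unset Strict Implicit.
Unset Printing Implicit Defensive.

Import GRing.Theory.
Local Open Scope ring_scope.

(** Write Q for I^t.  If p = (Q : f), then already p = (Q : x^m) for some
    monomial x^m of f: p kills every monomial of f modulo the monomial ideal Q,
    and (Q : f) contains the intersection of the (Q : x^m), hence their product,
    so primality of p puts one of them inside p ([ass_monomial_witness]).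

    The hypothesis on y = y_i forces y^alpha to divide x^m.  Otherwise the
    exponent of y in x^m is smaller than alpha, and Q and J agree on monomials
    of small y-degree, because (Q, y^alpha) = (J, y^alpha).  As y occurs in no
    minimal generator of J, membership of a monomial in (J : x^m) can be tested
    after deleting y from it, and there it means membership in (Q : x^m) = p.  Thus
    (J : x^m) = p \ y, and p \ y would be an associated prime of J
    ([witness_exponent_ge]).

    Since the y_i are distinct, u = \prod_i y_i^alpha_i divides x^m, say
    x^m = u x^w.  Then p = (Q : u x^w) = ((Q : u) : x^w), which is the forward
    half of (i); the same identity read backwards gives the converse for any u.
    For (ii), u \in I^l with l >= t lies in Q, so (Q : u) is the unit
    ideal, which has no associated primes, and (i) transfers this to Q. *)

(** * Ideals of a commutative ring *)

Section IdealLemmas.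
Variable R : comNzRingType.
Implicit Types (S Q P : R -> Prop) (f : R).

Lemma ideal_sum Q (I : eqType) (s : seq I) (F : I -> R) :
  is_ideal Q -> (forall i, i \in s -> Q (F i)) -> Q (\sum_(i <- s) F i).
Proof.
by case=> Q0 QD _ QF; rewrite big_seq; apply: (big_ind Q).
Qed.

Lemma ideal_mulr Q a r : is_ideal Q -> Q a -> Q (a * r).
Proof. by case=> _ _ QM Qa; rewrite mulrC; apply: QM. Qed.

Lemma ideal_gen_incl S r : S r -> ideal_gen S r.
Proof.
move=> Sr; exists 1%N, (fun=> 1), (fun=> r); split=> //.
by rewrite big_ord1 mul1r.
Qed.

Lemma ideal_gen_least S Q : is_ideal Q ->
  (forall r, S r -> Q r) -> forall r, ideal_gen S r -> Q r.
Proof.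
move=> idQ SQ r [k [c [g [Sg ->]]]]; apply: ideal_sum => // i _.
by case: idQ => _ _ QM; apply/QM/SQ.
Qed.

Lemma ideal_gen_ideal S : is_ideal (ideal_gen S).
Proof.
split.
- by exists 0%N, (fun=> 0), (fun=> 0); split; [case | rewrite big_ord0].
- move=> _ _ [k [c [g [Sg ->]]]] [l [d [h [Sh ->]]]].
  pose glue (u : 'I_k -> R) (v : 'I_l -> R) (i : 'I_(k + l)) :=
    match split i with inl j => u j | inr j => v j end.
  exists (k + l)%N, (glue c d), (glue g h); split.
    by move=> i; rewrite /glue; case: (split i).
  rewrite big_split_ord /glue; congr (_ + _); apply: eq_bigr => i _.
    by rewrite (unsplitK (inl i)).
  by rewrite (unsplitK (inr i)).
- move=> r _ [k [c [g [Sg ->]]]].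
  exists k, (fun i => r * c i), g; split=> //.
  by rewrite big_distrr /=; apply: eq_bigr => i _; rewrite mulrA.
Qed.

Lemma is_ideal_ext P Q : ieq P Q -> is_ideal Q -> is_ideal P.
Proof.
move=> PQ [Q0 QD QM]; split; first exact/PQ.
- by move=> a b /PQ Qa /PQ Qb; apply/PQ/QD.
- by move=> r a /PQ Qa; apply/PQ/QM.
Qed.

Lemma prime_ideal_ext P Q : ieq P Q -> prime_ideal Q -> prime_ideal P.
Proof.
move=> PQ [idQ Q1 QM]; split; first exact: is_ideal_ext idQ.
- by move/PQ.
- by move=> a b /PQ /QM []; [left | right]; apply/PQ.
Qed.

(** The factors beyond the [t]-th are absorbed as a coefficient. *)
Lemma ideal_pow_anti Q t l r : (t <= l)%N -> ideal_pow Q l r -> ideal_pow Q t r.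
Proof.
move=> /subnKC <-; apply: ideal_gen_least; first exact: ideal_gen_ideal.
move=> _ [g [Qg ->]]; rewrite big_split_ord /=.
apply: ideal_mulr; first exact: ideal_gen_ideal.
by apply: ideal_gen_incl; exists (fun i => g (lshift _ i)).
Qed.

Lemma ass_colon Q f P : ass (ideal_colon Q f) P -> ass Q P.
Proof.
case=> pP [g Pg]; split=> //; exists (g * f) => r.
by rewrite (Pg r) /ideal_colon -mulrA.
Qed.

Lemma ass_unit_ideal Q P : (forall r, Q r) -> ~ ass Q P.
Proof. by move=> QT [[_ P1 _] [g Pg]]; apply/P1/Pg/QT. Qed.

End IdealLemmas.

(** * Monomial ideals *)

Section MonomialLemmas.
Variables (n : nat) (K : fieldType).
Implicit Types (J p Q : {mpoly K[n]} -> Prop) (r : {mpoly K[n]}).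
Implicit Types G U : 'X_{1..n} -> Prop.

(** The polynomials supported on an upward closed set of monomials form an
    ideal, so it is enough to look at the generators. *)
Lemma ideal_gen_msupp (S : {mpoly K[n]} -> Prop) U r :
  (forall k m, U m -> U (k + m)%MM) ->
  (forall g, S g -> forall m, m \in msupp g -> U m) ->
  ideal_gen S r -> forall m, m \in msupp r -> U m.
Proof.
move=> Uup US.
apply: (ideal_gen_least (Q := fun r => forall m, m \in msupp r -> U m)) => //.
split.
- by move=> m; rewrite msupp0.
- move=> a b Ua Ub m /msuppD_le; rewrite mem_cat => /orP[]; first exact: Ua.
  exact: Ub.
- by move=> c a Ua _ /msuppM_le /allpairsP[[k m] /= [_ /Ua Um ->]]; apply: Uup.
Qed.

Lemma mon_gen_msupp G r m :
  mon_gen G r -> m \in msupp r -> exists2 g, G g & (g <= m)%MM.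
Proof.
move=> Gr; move: m; apply: ideal_gen_msupp Gr => [k m [g Gg le_gm] | _ [g Gg ->] m].
  by exists g => //; apply: lepm_trans le_gm _; rewrite lem_addl.
by rewrite msuppX inE => /eqP ->; exists g; rewrite ?lepm_refl.
Qed.

Lemma ideal_mpolyX_le J m m' :
  is_ideal J -> (m <= m')%MM -> J 'X_[m] -> J 'X_[m'].
Proof.
by move=> [_ _ JM] le_mm' Jm; rewrite -(submK le_mm') mpolyXD; apply: JM.
Qed.

Lemma mon_gen_ideal G : is_ideal (mon_gen (K := K) G).
Proof. exact: ideal_gen_ideal. Qed.

Lemma mon_gen_mpolyX G g m : G g -> (g <= m)%MM -> mon_gen (K := K) G 'X_[m].
Proof.
move=> Gg le_gm; apply: ideal_mpolyX_le le_gm _; first exact: mon_gen_ideal.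
by apply: ideal_gen_incl; exists g.
Qed.

Lemma ideal_msupp Q r :
  is_ideal Q -> (forall m, m \in msupp r -> Q 'X_[m]) -> Q r.
Proof.
move=> idQ Qm; rewrite (mpolyE r); apply: ideal_sum => // m /Qm.
by rewrite -mul_mpolyC; case: idQ => _ _; apply.
Qed.

(** The generator-free description used throughout: a monomial ideal contains
    every monomial of each of its elements. *)
Lemma monomial_idealP J :
  monomial_ideal J <->
  is_ideal J /\ (forall r m, J r -> m \in msupp r -> J 'X_[m]).
Proof.
split=> [[G JG] | [idJ Jsupp]].
  split; first exact: is_ideal_ext JG (mon_gen_ideal G).
  move=> r m /JG Gr /(mon_gen_msupp Gr)[g Gg le_gm].
  exact/JG/(mon_gen_mpolyX Gg).
exists (fun m => J 'X_[m]) => r; split=> [Jr|].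
  apply: ideal_msupp; first exact: mon_gen_ideal.
  by move=> m /(Jsupp _ _ Jr) Jm; apply: mon_gen_mpolyX (lepm_refl m).
by apply: ideal_gen_least => // _ [m Jm ->].
Qed.

Lemma mem_monomial_ideal J r : monomial_ideal J ->
  J r <-> (forall m, m \in msupp r -> J 'X_[m]).
Proof.
move=> /monomial_idealP[idJ Jsupp]; split=> [Jr m|]; first exact: Jsupp.
exact: ideal_msupp.
Qed.

Lemma mem_monomial_idealMX J r m : monomial_ideal J ->
  J (r * 'X_[m]) <-> (forall v, v \in msupp r -> J 'X_[v + m]).
Proof.
move=> monJ; rewrite (mem_monomial_ideal _ monJ); split=> [Jrm v rv | Jrm w].
  by apply: Jrm; rewrite (perm_mem (msuppMX r m)) addmC map_f.
by rewrite (perm_mem (msuppMX r m)) => /mapP[v rv ->]; rewrite addmC; apply: Jrm.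
Qed.

Lemma msupp_prod (I : eqType) (s : seq I) (g : I -> {mpoly K[n]}) m :
  uniq s -> m \in msupp (\prod_(i <- s) g i) ->
  exists h : I -> 'X_{1..n},
    (forall i, i \in s -> h i \in msupp (g i)) /\
    'X_[m] = \prod_(i <- s) 'X_[h i] :> {mpoly K[n]}.
Proof.
elim: s m => [|a s IHs] m /=.
  rewrite !big_nil msupp1 inE => _ /eqP ->.
  by exists (fun=> 0%MM); rewrite big_nil mpolyX0.
case/andP=> a_s /IHs{}IHs; rewrite big_cons.
move=> /msuppM_le /allpairsP[[k m'] /= [gk /IHs[h [gh Em']] ->]].
exists (fun i => if i == a then k else h i); split=> [i|].
  by rewrite inE; case: eqP => [-> | _ /gh].
rewrite mpolyXD Em' big_cons eqxx; congr (_ * _).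
rewrite !big_seq; apply: eq_bigr => i si.
by case: eqP => // ia; rewrite -ia si in a_s.
Qed.

Lemma monomial_ideal_pow J t :
  monomial_ideal J -> monomial_ideal (ideal_pow J t).
Proof.
move=> /monomial_idealP[idJ Jsupp]; apply/monomial_idealP.
have idJt : is_ideal (ideal_pow J t) by apply: ideal_gen_ideal.
split=> // r m Jr; move: m; apply: ideal_gen_msupp Jr => [k m|].
  by apply: ideal_mpolyX_le; rewrite ?lem_addl.
move=> _ [g [Jg ->]] m /msupp_prod[|h [gh Em]]; first exact: index_enum_uniq.
rewrite Em; apply: ideal_gen_incl; exists (fun i => 'X_[h i]); split=> // i.
by apply: Jsupp (Jg i) (gh i _); rewrite mem_index_enum.
Qed.

Definition minimal_monomials J (m : 'X_{1..n}) : Prop :=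
  J 'X_[m] /\ forall g, J 'X_[g] -> (g <= m)%MM -> g = m.

Lemma minimal_monomial_below J m :
  J 'X_[m] -> exists2 g, minimal_monomials J g & (g <= m)%MM.
Proof.
have [d] := ubnP (mdeg m); elim: d m => // d IHd m; rewrite ltnS => le_md Jm.
have [[g [Jg [le_gm neq_gm]]] | minm] :=
  classic (exists g, J 'X_[g] /\ (g <= m)%MM /\ g <> m).
  have [|g' ming' le_g'g] := IHd g _ Jg; last first.
    by exists g' => //; apply: lepm_trans le_gm.
  apply: leq_trans le_md; rewrite -(submK le_gm) mdegD -[X in (X < _)%N]add0n.
  rewrite ltn_add2r lt0n mdeg_eq0; apply/eqP => mg0; apply: neq_gm.
  by rewrite -[RHS](submK le_gm) mg0 add0m.
exists m; last exact: lepm_refl.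
split=> // g Jg le_gm; apply: NNPP => neq_gm; apply: minm.
by exists g.
Qed.

Lemma minimal_monomials_min_mon_gens J :
  monomial_ideal J -> min_mon_gens J (minimal_monomials J).
Proof.
move=> monJ; have [idJ Jsupp] := (monomial_idealP J).1 monJ; split=> [r|].
  rewrite (mem_monomial_ideal _ monJ); split=> [Jr | Gr].
    apply: ideal_msupp; first exact: mon_gen_ideal.
    by move=> m /Jr /minimal_monomial_below[g /mon_gen_mpolyX]; apply.
  move=> m /(mon_gen_msupp Gr)[g [Jg _] le_gm].
  exact: ideal_mpolyX_le Jg.
move=> G sGJ JG m [/JG Gm minm].
have [|g Gg le_gm] := mon_gen_msupp (m := m) Gm.
  by rewrite msuppX mem_head.
by rewrite -(minm g) //; case: (sGJ _ Gg).
Qed.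

Definition erase (y : 'I_n) (m : 'X_{1..n}) : 'X_{1..n} :=
  [multinom (if i == y then 0 else m i)%N | i < n].

Lemma erase_le y m : (erase y m <= m)%MM.
Proof. by apply/mnm_lepP => i; rewrite mnmE; case: eqP. Qed.

(** A minimal generator below [m] avoids [y], hence is below [erase y m]. *)
Lemma ideal_supp_erase J y m : monomial_ideal J -> ~ ideal_supp J y ->
  J 'X_[m] -> J 'X_[erase y m].
Proof.
move=> monJ yJ /minimal_monomial_below[g ming le_gm].
have [idJ _] := (monomial_idealP J).1 monJ.
apply: ideal_mpolyX_le ming.1 => //; apply/mnm_lepP => i; rewrite mnmE.
case: eqP => [-> | _]; last by move/mnm_lepP: le_gm.
rewrite leqNgt lt0n; apply/negP => gy0; apply: yJ.
exists (minimal_monomials J); split; first exact: minimal_monomials_min_mon_gens.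
by exists g => //; rewrite inE.
Qed.

Lemma add_power_low_exponent Q J y a (m : 'X_{1..n}) :
  is_ideal Q -> monomial_ideal J ->
  (forall r, ideal_add_elt Q ('X_y ^+ a) r -> ideal_add_elt J ('X_y ^+ a) r) ->
  (m y < a)%N -> Q 'X_[m] -> J 'X_[m].
Proof.
move=> [Q0 _ QM] /monomial_idealP[idJ Jsupp] QJ lt_ma Qm.
have [q [c [Jq Em]]] : ideal_add_elt J ('X_y ^+ a) 'X_[m].
  by apply: QJ; exists 'X_[m], 0; rewrite mulr0 addr0.
have: m \in msupp (q + 'X_y ^+ a * c) by rewrite -Em msuppX mem_head.
move/msuppD_le; rewrite mem_cat => /orP[/(Jsupp _ _ Jq) // |].
rewrite mulrC mpolyXn (perm_mem (msuppMX _ _)) => /mapP[k _ mE].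
by move: lt_ma; rewrite mE mnmDE mulmnE mnm1E eqxx mul1n ltnNge leq_addr.
Qed.

(** * Primes generated by variables *)

Definition var_ideal (A : {set 'I_n}) : {mpoly K[n]} -> Prop :=
  ideal_gen (fun f => exists2 i, i \in A & f = 'X_i).

Lemma var_ideal_ideal A : is_ideal (var_ideal A).
Proof. exact: ideal_gen_ideal. Qed.

Lemma var_ideal_monomial A : monomial_ideal (var_ideal A).
Proof.
exists (fun m => exists2 i, i \in A & m = U_(i)%MM) => r.
split; apply: ideal_gen_least; try exact: ideal_gen_ideal.
  by move=> _ [i Ai ->]; apply: ideal_gen_incl; exists U_(i)%MM => //; exists i.
by move=> _ [_ [i Ai ->] ->]; apply: ideal_gen_incl; exists i.
Qed.

Lemma var_ideal_mpolyX A (m : 'X_{1..n}) :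
  var_ideal A 'X_[m] <-> exists2 i, i \in A & m i != 0%N.
Proof.
split=> [Am | [i Ai mi]]; last first.
  apply: (@ideal_mpolyX_le _ U_(i)); rewrite ?lep1mP //.
    exact: var_ideal_ideal.
  by apply: ideal_gen_incl; exists i.
have: m \in msupp ('X_[m] : {mpoly K[n]}) by rewrite msuppX mem_head.
apply: (ideal_gen_msupp (U := fun m => exists2 i, i \in A & m i != 0%N)) Am m.
  move=> k {}m [i Ai mi]; exists i => //.
  by rewrite mnmDE addn_eq0 negb_and mi orbT.
move=> _ [i Ai ->] k; rewrite msuppX inE => /eqP ->; exists i => //.
by rewrite mnm1E eqxx.
Qed.

(** The quotient by [var_ideal A], realised inside the polynomial ring itself;
    primality of [var_ideal A] comes from this ring being a domain. *)
Definition kill_vars (A : {set 'I_n}) (r : {mpoly K[n]}) : {mpoly K[n]} :=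
  r \mPo [tuple if i \in A then 0 else 'X_i | i < n].

Lemma sub_kill_vars A r : var_ideal A (r - kill_vars A r).
Proof.
have idA := var_ideal_ideal A.
rewrite /kill_vars {1}(mpolyE r) comp_mpolyEX -sumrB.
apply: ideal_sum => // m _; rewrite -scalerBr -mul_mpolyC.
case: (idA) => A0 _ AM; apply: AM; rewrite comp_mpolyX.
have [/existsP[i /andP[Ai mi]] | Am] := boolP [exists i in A, m i != 0%N].
  rewrite (bigD1 i) //= tnth_mktuple Ai expr0n (negbTE mi) mul0r subr0.
  by apply/var_ideal_mpolyX; exists i.
rewrite [X in _ - X](_ : _ = 'X_[m]) ?subrr // mpolyXE_id.
apply: eq_bigr => i _; rewrite tnth_mktuple; case: ifP => // Ai.
move/existsPn: Am => /(_ i); rewrite Ai negbK => /eqP ->.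
by rewrite !expr0.
Qed.

Lemma var_ideal_kill_vars A r : var_ideal A r <-> kill_vars A r = 0.
Proof.
split=> [|r0]; last by rewrite -[r]subr0 -r0; apply: sub_kill_vars.
apply: (ideal_gen_least (Q := fun r => kill_vars A r = 0)).
  split=> [|a b|c a]; rewrite /kill_vars; first exact: comp_mpoly0.
    by rewrite comp_mpolyD => -> ->; rewrite addr0.
  by rewrite rmorphM /= => ->; rewrite mulr0.
move=> _ [i Ai ->].
by rewrite /kill_vars comp_mpolyXU -tnth_nth tnth_mktuple Ai.
Qed.

Lemma var_ideal_prime A : prime_ideal (var_ideal A).
Proof.
split; first exact: var_ideal_ideal.
  by rewrite -mpolyX0 => /var_ideal_mpolyX[i _]; rewrite mnm0E.
move=> a b /var_ideal_kill_vars; rewrite /kill_vars rmorphM /= => /eqP.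
by rewrite mulf_eq0 => /orP[] /eqP ab0; [left | right];
  apply/var_ideal_kill_vars.
Qed.

Lemma prime_minus_var_ideal p A y :
  ieq p (var_ideal A) -> ieq (prime_minus p y) (var_ideal (A :\ y)).
Proof.
move=> pA r; split; apply: ideal_gen_least; try exact: ideal_gen_ideal.
  move=> _ [i [/pA /var_ideal_mpolyX[j Aj ij] iy ->]].
  apply: ideal_gen_incl; exists i => //; rewrite !inE iy.
  by move: ij; rewrite mnm1E eqb0 negbK => /eqP ->.
move=> _ [i Ayi ->]; move: Ayi; rewrite !inE => /andP[iy Ai].
apply: ideal_gen_incl; exists i; split=> //.
by apply/pA; apply: ideal_gen_incl; exists i.
Qed.

(** * Monomial witnesses of associated primes *)

(** If the conclusion fails, each (Q : x^m) contains some g_m outside p, and the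
    product of the g_m lies in (Q : f) = p, against primality. *)
Lemma ass_monomial_witness Q p : monomial_ideal Q -> monomial_ideal p ->
  ass Q p -> exists m, ieq p (ideal_colon Q 'X_[m]).
Proof.
move=> monQ monp [[idp p1 pM] [f pf]].
have [idQ Qsupp] := (monomial_idealP Q).1 monQ.
have sub_p m r : m \in msupp f -> p r -> Q (r * 'X_[m]).
  move=> fm pr; apply/mem_monomial_idealMX => // v rv.
  have /pf := (mem_monomial_ideal r monp).1 pr v rv.
  rewrite /ideal_colon mulrC => /mem_monomial_idealMX.
  by rewrite addmC; apply.
apply: NNPP => no_witness.
have avoid m : m \in msupp f -> exists2 g, ~ p g & Q (g * 'X_[m]).
  move=> fm; apply: NNPP => no_g; apply: no_witness; exists m => r.
  split=> [|Qr]; first exact: sub_p.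
  by apply: NNPP => pr; apply: no_g; exists r.
have [g pg Qg] : exists2 g, ~ p g & forall m, m \in msupp f -> Q (g * 'X_[m]).
  elim: (msupp f : seq _) avoid => [|m s IHs] avoid; first by exists 1.
  have [g pg Qg] := avoid m (mem_head m s).
  have [|h ph Qh] := IHs; first by move=> k sk; apply: avoid; rewrite inE sk orbT.
  exists (g * h) => [/pM[] // | k]; rewrite inE => /predU1P[-> | /Qh Qk].
    by rewrite mulrAC; apply: ideal_mulr.
  by rewrite -mulrA mulrC; apply: ideal_mulr.
apply/pg/pf; rewrite /ideal_colon (mpolyE f) big_distrr /=.
apply: ideal_sum => // m /Qg Qm; rewrite -scalerAr -mul_mpolyC.
by case: idQ => _ _; apply.
Qed.

(** If the exponent of [y] in [m] were below [a], then (J : x^m) = p \ y.  The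
    factor [y] is erased from the monomials of the multiplier only: the exponent
    of [y] in the product is then that of [m], where [Q] and [J] agree. *)
Lemma witness_exponent_ge Q J p A y a (m : 'X_{1..n}) :
  monomial_ideal Q -> monomial_ideal J -> ~ ideal_supp J y ->
  ieq (ideal_add_elt Q ('X_y ^+ a)) (ideal_add_elt J ('X_y ^+ a)) ->
  ieq p (var_ideal A) -> ~ ass J (prime_minus p y) ->
  ieq p (ideal_colon Q 'X_[m]) -> (a <= m y)%N.
Proof.
move=> monQ monJ yJ QJ pA assJ pm; rewrite leqNgt; apply/negP => lt_ma.
have [[idQ _] [idJ _]] := ((monomial_idealP Q).1 monQ, (monomial_idealP J).1 monJ).
have pyA := prime_minus_var_ideal y pA.
apply: assJ; split; first exact: prime_ideal_ext pyA (var_ideal_prime _).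
exists 'X_[m] => r; rewrite (pyA r) /ideal_colon.
rewrite (mem_monomial_ideal _ (var_ideal_monomial _)) mem_monomial_idealMX //.
suff vE v : var_ideal (A :\ y) 'X_[v] <-> J 'X_[v + m].
  by split=> H v /H /vE.
have y_vm : ((erase y v + m)%MM y < a)%N by rewrite mnmDE mnmE eqxx.
have -> : var_ideal (A :\ y) 'X_[v] <-> var_ideal A 'X_[erase y v].
  rewrite !var_ideal_mpolyX; split=> -[i].
    rewrite !inE => /andP[/negbTE iy Ai] vi.
    by exists i => //; rewrite mnmE iy.
  rewrite mnmE; case: (boolP (i == y)) => //= iy Ai vi.
  by exists i => //; rewrite !inE iy.
rewrite -(pA 'X_[erase y v]) (pm 'X_[erase y v]) /ideal_colon -mpolyXD.
split=> [Qv | /(ideal_supp_erase monJ yJ) Jv].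
  have /ideal_mpolyX_le : J 'X_[erase y v + m].
    by apply: add_power_low_exponent idQ monJ _ y_vm Qv => w /QJ.
  apply=> //; apply/mnm_lepP => i; rewrite !mnmDE leq_add2r.
  exact: (mnm_lepP (erase_le y v)).
apply: add_power_low_exponent (idJ) monQ _ y_vm _ => [w /QJ //|].
apply: (ideal_mpolyX_le idJ) Jv; apply/mnm_lepP => i; rewrite !(mnmE, mnmDE).
by case: eqP.
Qed.

End MonomialLemmas.

Lemma sum_powers_le (n s : nat) (y : 'I_s -> 'I_n) (alpha : 'I_s -> nat)
    (m : 'X_{1..n}) :
  injective y -> (forall i, (alpha i <= m (y i))%N) ->
  (\sum_(i < s) U_(y i) *+ alpha i <= m)%MM.
Proof.
move=> inj_y le_m; apply/mnm_lepP => j; rewrite mnm_sumE.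
have [/existsP[i /eqP <-] | jy] := boolP [exists i, y i == j].
  rewrite (bigD1 i) //= big1 ?addn0 => [|k /negbTE ki].
    by rewrite mulmnE mnm1E eqxx mul1n.
  by rewrite mulmnE mnm1E (inj_eq inj_y) ki.
rewrite big1 // => i _; rewrite mulmnE mnm1E.
by move/existsPn: jy => /(_ i) /negbTE ->.
Qed.

Theorem theorem3p1 (K : fieldType) (n : nat)
    (I p : {mpoly K[n]} -> Prop) (t s : nat)
    (y : 'I_s -> 'I_n) (alpha : 'I_s -> nat)
    (hI : monomial_ideal I) (hp : monomial_prime p) (ht : (1 <= t)%N)
    (hy : injective y)
    (hJ : forall i : 'I_s,
        (1 <= alpha i)%N /\
        exists J : {mpoly K[n]} -> Prop,
          [/\ monomial_ideal J,
              ~ ideal_supp J (y i),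
              ieq (ideal_add_elt (ideal_pow I t) ('X_(y i) ^+ alpha i))
                  (ideal_add_elt J ('X_(y i) ^+ alpha i))
            & ~ ass J (prime_minus p (y i))]) :
  (ass (ideal_pow I t) p <->
     ass (ideal_colon (ideal_pow I t) (\prod_(i < s) 'X_(y i) ^+ alpha i)) p)
  /\
  ((exists2 l : nat, (t <= l)%N &
      ideal_pow I l (\prod_(i < s) 'X_(y i) ^+ alpha i)) ->
   ~ ass (ideal_pow I t) p).
Proof.
set u := \prod_(i < s) _.
have uE : u = 'X_[\sum_(i < s) U_(y i) *+ alpha i].
  by rewrite -mprodXE; apply: eq_bigr => i _; rewrite mpolyXn.
have monQ : monomial_ideal (ideal_pow I t) by apply: monomial_ideal_pow.
have [A pA] := hp.
have monp : monomial_ideal p.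
  have [G AG] := var_ideal_monomial K A; exists G => r.
  by rewrite (pA r); apply: AG.
have fwd : ass (ideal_pow I t) p -> ass (ideal_colon (ideal_pow I t) u) p.
  move=> assp; have [m pm] := ass_monomial_witness monQ monp assp.
  split; first by case: assp.
  have le_um : (\sum_(i < s) U_(y i) *+ alpha i <= m)%MM.
    apply: sum_powers_le => // i; have [_ [J [monJ yJ QJ assJ]]] := hJ i.
    exact: witness_exponent_ge monQ monJ yJ QJ pA assJ pm.
  exists 'X_[m - \sum_(i < s) U_(y i) *+ alpha i] => r.
  by rewrite (pm r) /ideal_colon uE -mulrA -mpolyXD submK.
split; first by split=> //; apply: ass_colon.
case=> l le_tl Iu /fwd; apply: ass_unit_ideal => r.
have [_ _ QM] : is_ideal (ideal_pow I t) by apply: ideal_gen_ideal.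
exact/QM/(ideal_pow_anti le_tl).
Qed.
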